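(* Let $\mathcal{X}=\mathbb{R}^n$, $\mathcal{Y}=\mathbb{R}^m$, $\mathcal{Z}=\mathbb{R}^l$ (Euclidean spaces), $(A,\mathfrak{L},\mu)\in\mathbb{R}^{m\times n}\times\mathbb{R}^{l\times n}\times\mathbb{R}_{++}$ with $\operatorname{rank}(\mathfrak{L})=l$. Let $\mathfrak{Z}$ be a finite dimensional real Hilbert space, $\mathbf{C}\subset\mathfrak{Z}$ nonempty closed convex, $\mathfrak{C}:\mathbb{R}^n\to\mathfrak{Z}$ linear with $\mathbf{C}\cap\operatorname{ran}\mathfrak{C}\neq\emptyset$, $\Psi\in\Gamma_0(\mathbb{R}^l)$ coercive with $\operatorname{dom}\Psi=\mathbb{R}^l$, and $y\in\mathbb{R}^m$. Choose a nonsingular $\tilde{\mathfrak{L}}\in\mathbb{R}^{n\times n}$ satisfying $\begin{bmatrix}\mathrm{O}_{l\times(n-l)}&\mathrm{I}_l\end{bmatrix}\tilde{\mathfrak{L}}=\mathfrak{L}$. Then $$B=B_\theta:=\sqrt{\theta/\mu}\,\Lambda^{1/2}U^{\mathsf{T}}\in\mathbb{R}^{l\times l},\qquad\theta\in[0,1],$$ ensures $J_{\mathbf{\Psi}_{B_c}\circ\mathfrak{L}_c}\in\Gamma_0(\mathbb{R}^n)$, where $\begin{bmatrix}\tilde{A}_1&\tilde{A}_2\end{bmatrix}=A(\tilde{\mathfrak{L}})^{-1}$ (with $\tilde A_1\in\mathbb{R}^{m\times(n-l)}$, $\tilde A_2\in\mathbb{R}^{m\times l}$) and $$U\Lambda U^{\mathsf{T}}:=\tilde{A}_2^{\mathsf{T}}\tilde{A}_2-\tilde{A}_2^{\mathsf{T}}\tilde{A}_1\big(\tilde{A}_1^{\mathsf{T}}\tilde{A}_1\big)^\dagger\tilde{A}_1^{\mathsf{T}}\tilde{A}_2$$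 is an eigendecomposition.
   Context: $\mathbb{R}_{++}$ is the set of positive reals; $\mathrm{I}_l$ the identity matrix, $\mathrm{O}_{l\times k}$ the zero matrix; $^\dagger$ the Moore–Penrose pseudoinverse. In the eigendecomposition $U$ is orthogonal and $\Lambda$ diagonal. $\Gamma_0(\mathcal{H})$ is the set of proper lower semicontinuous convex functions $\mathcal{H}\to(-\infty,\infty]$; $\operatorname{dom}\Psi:=\{z\mid\Psi(z)<\infty\}$; coercive means $\Psi(z)\to\infty$ as $\|z\|\to\infty$. $\iota_{\mathbf{C}}$ is the indicator function of $\mathbf{C}$ ($0$ on $\mathbf{C}$, $\infty$ elsewhere). For $B\in\mathbb{R}^{l\times l}$ (so $\tilde{\mathcal{Z}}=\mathbb{R}^l$) define $\mathcal{Z}_c:=\tilde{\mathcal{Z}}_c:=\mathbb{R}^l\times\mathfrak{Z}$ (sum inner product), $\mathfrak{L}_c:\mathbb{R}^n\to\mathcal{Z}_c:x\mapsto(\mathfrak{L}x,\mathfrak{C}x)$, $B_c:\mathcal{Z}_c\to\tilde{\mathcal{Z}}_c:(z_1,z_2)\mapsto(Bz_1,0_{\mathfrak{Z}})$, $\mathbf{\Psi}:\mathcal{Z}_c\to(-\infty,\infty]:(z_1,z_2)\mapsto\Psi(z_1)+\iota_{\mathbf{C}}(z_2)$, $$\mathbf{\Psi}_{B_c}(\cdot):=\mathbf{\Psi}(\cdot)-\min_{v\in\mathcal{Z}_c}\Big[\mathbf{\Psi}(v)+\tfrac12\|B_c(\cdot-v)\|_{\tilde{\mathcal{Z}}_c}^2\Big],\qquad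 J_{\mathbf{\Psi}_{B_c}\circ\mathfrak{L}_c}(x):=\tfrac12\|y-Ax\|^2+\mu\,\mathbf{\Psi}_{B_c}\circ\mathfrak{L}_c(x).$$ *)

(* Defs.v *)
From HB Require Import structures.
From mathcomp Require Import all_boot all_order all_algebra.
From mathcomp Require Import all_classical all_reals all_analysis.
Import Order.TTheory GRing.Theory Num.Theory.
Import numFieldNormedType.Exports.

Set Implicit Arguments.
Unset Strict Implicit.
Unset Printing Implicit Defensive.

Local Open Scope classical_set_scope.
Local Open Scope ring_scope.

(* A finite-dimensional real Hilbert space is an element of this class together
   with a form [ip : {dot Z for idfun}] such that [`|z| ^+ 2 = ip z z]. *)
#[short(type="finDimNormedModType")]
HB.structure Definition FinDimNormedModule (R : realType) :=
  {V of NormedModule R V & Vector R V}.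

(* The library norm [`|v|] on column vectors is the sup norm; it induces the
   usual topology, but Euclidean lengths must go through [enorm]. *)
Definition enorm2 (R : realType) n (v : 'cV[R]_n) : R := (v^T *m v) 0 0.
Definition enorm (R : realType) n (v : 'cV[R]_n) : R := Num.sqrt (enorm2 v).

Section MoorePenrose.
Context {R : realType}.

Definition is_mpinv m n (A : 'M[R]_(m, n)) (X : 'M[R]_(n, m)) : Prop :=
  [/\ A *m X *m A = A, X *m A *m X = X,
      (A *m X)^T = A *m X & (X *m A)^T = X *m A].

(* Not the library's [pinvmx], which is only some generalised inverse. *)
Definition mpinv m n (A : 'M[R]_(m, n)) : 'M[R]_(n, m) :=
  xget 0 [set X | is_mpinv A X].

Lemma is_mpinv_uniq m n (A : 'M[R]_(m, n)) X Y :
  is_mpinv A X -> is_mpinv A Y -> X = Y.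
Proof.
move=> [a1 a2 a3 a4] [b1 b2 b3 b4].
have AXY : A *m X = A *m Y.
  by rewrite -{1}b1 -!mulmxA mulmxA -b3 -a3 -trmx_mul !mulmxA a1.
have XYA : X *m A = Y *m A.
  by rewrite -{1}b1 -mulmxA mulmxA -a4 -b4 -trmx_mul -!mulmxA (mulmxA A X) a1.
by rewrite -a2 -mulmxA AXY mulmxA XYA b2.
Qed.

Lemma row_free_gram_unit r n (G : 'M[R]_(r, n)) :
  row_free G -> G *m G^T \in unitmx.
Proof.
move=> Gf; rewrite -row_free_unit -kermx_eq0; apply/eqP/eqP/rowV0P => v.
move=> /sub_kermxP; rewrite mulmxA => vGG.
have : v *m G *m (v *m G)^T = 0 by rewrite trmx_mul mulmxA vGG mul0mx.
have vG0 (w : 'rV[R]_n) : w *m w^T = 0 -> w = 0.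
  move=> /matrixP/(_ 0 0); rewrite !mxE => /psumr_eq0P ww.
  apply/rowP => j; have /eqP : w 0 j * w^T j 0 = 0.
    by apply: ww => // i _; rewrite [w^T _ _]mxE -expr2 sqr_ge0.
  by rewrite [w^T _ _]mxE -expr2 sqrf_eq0 => /eqP ->; rewrite mxE.
move=> /vG0 {}vG0.
by apply/eqP; rewrite -(mulmx_free_eq0 _ Gf) vG0.
Qed.

Lemma mpinvP m n (A : 'M[R]_(m, n)) : is_mpinv A (mpinv A).
Proof.
suff [X AX] : exists X, is_mpinv A X by exact: (xgetPex 0 (ex_intro _ X AX)).
have := mulmx_base A; move: (row_base A) (col_base A) (row_base_free A)
  (col_base_full A); move: (\rank A) => r G C Gf Cf AE.
have GU : G *m G^T \in unitmx by exact: row_free_gram_unit.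
have CU : C^T *m C \in unitmx.
  have := @row_free_gram_unit _ _ C^T; rewrite trmxK; apply.
  by rewrite /row_free mxrank_tr.
pose P := invmx (G *m G^T); pose Q := invmx (C^T *m C).
have PT : P^T = P by rewrite /P trmx_inv trmx_mul trmxK.
have QT : Q^T = Q by rewrite /Q trmx_inv trmx_mul trmxK.
have GP : G *m G^T *m P = 1%:M by rewrite mulmxV.
have QC : Q *m (C^T *m C) = 1%:M by rewrite mulVmx.
pose X := G^T *m P *m (Q *m C^T).
have AX : A *m X = C *m Q *m C^T.
  by rewrite -AE /X -!mulmxA (mulmxA G) (mulmxA (G *m _)) GP mul1mx.
have XA : X *m A = G^T *m P *m G.
  by rewrite -AE /X -!mulmxA (mulmxA C^T) (mulmxA Q) QC mul1mx.
exists X; split.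
- by rewrite AX -AE -!mulmxA (mulmxA C^T) (mulmxA Q) QC mul1mx.
- by rewrite XA /X -!mulmxA (mulmxA G) (mulmxA (G *m _)) GP mul1mx.
- by rewrite AX !trmx_mul trmxK QT mulmxA.
- by rewrite XA !trmx_mul trmxK PT mulmxA.
Qed.

End MoorePenrose.

(* [U *m diag_mx d *m U^T] is an eigendecomposition of [S]. *)
Definition is_eigendecomposition (R : realType) l (S U : 'M[R]_l)
    (d : 'rV[R]_l) : Prop :=
  U^T *m U = 1%:M /\ U *m diag_mx d *m U^T = S.

Section ConvexAnalysis.
Context {R : realType}.
Local Open Scope ereal_scope.

Definition eproper (H : Type) (f : H -> \bar R) : Prop :=
  (forall x, f x != -oo) /\ (exists x, f x < +oo).

Definition econvex (H : lmodType R) (f : H -> \bar R) : Prop :=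
  forall (x y : H) (t : R), (0 < t < 1)%R ->
    f (t *: x + (1 - t) *: y)%R <= t%:E * f x + (1 - t)%:E * f y.

Definition Gamma0 (H : normedModType R) : set (H -> \bar R) :=
  [set f | [/\ eproper f, lower_semicontinuous f & econvex f]].

Definition edom (H : Type) (f : H -> \bar R) : set H := [set z | f z < +oo].

Definition coercive n (f : 'cV[R]_n -> \bar R) : Prop :=
  forall M : R, exists r : R, forall z, (r < enorm z)%R -> M%:E < f z.

Definition eindicator (H : Type) (C : set H) (z : H) : \bar R :=
  if z \in C then 0 else +oo.

(* The minimum over the whole domain when it is attained.  The junk value [+oo]
   is chosen so that an infimum that is not attained is never silently accepted:
   [x - +oo = -oo] for all [x], so a function built by subtracting such a
   "minimum" is not proper. *)
Definition emin (H : Type) (f : H -> \bar R) : \bar R :=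
  xget +oo [set m | exists2 v, f v = m & forall w, m <= f w].

Lemma eminE (H : Type) (f : H -> \bar R) v :
  (forall w, f v <= f w) -> emin f = f v.
Proof.
move=> fv; apply: xget_unique; first by exists v.
by move=> m [w <- fw]; apply/le_anti; rewrite fv fw.
Qed.

End ConvexAnalysis.

Section ConstrainedModel.
Context {R : realType} {m n l : nat} {Z : finDimNormedModType R}.
Variables (ip : {dot Z for idfun}).
Variables (A : 'M[R]_(m, n)) (L : 'M[R]_(l, n)) (mu : R) (y : 'cV[R]_m).
Variables (Cset : set Z) (Cop : {linear 'cV[R]_n -> Z}).
Variables (Psi : 'cV[R]_l -> \bar R) (B : 'M[R]_l).

(* Squared norm of the Hilbert direct sum of R^l and Z. *)
Definition sum_norm2 (z : 'cV[R]_l * Z) : R := enorm2 z.1 + ip z.2 z.2.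

Definition L_c (x : 'cV[R]_n) : 'cV[R]_l * Z := (L *m x, Cop x).

Definition B_c (z : 'cV[R]_l * Z) : 'cV[R]_l * Z := (B *m z.1, 0).

Definition bPsi (z : 'cV[R]_l * Z) : \bar R :=
  (Psi z.1 + eindicator Cset z.2)%E.

Definition bPsi_B (z : 'cV[R]_l * Z) : \bar R :=
  (bPsi z - emin (fun v => bPsi v + (2^-1 * sum_norm2 (B_c (z - v)))%:E))%E.

Definition J_c (x : 'cV[R]_n) : \bar R :=
  ((2^-1 * enorm2 (y - A *m x))%:E + mu%:E * bPsi_B (L_c x))%E.

End ConstrainedModel.

(* [Num.sqrt] vanishes on negative numbers, so this is the intended matrix only
   for [d >= 0]; this holds for the spectrum of the positive semidefinite matrix
   [schur_mp A1 A2] below. *)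
Definition B_theta (R : realType) l (theta mu : R) (U : 'M[R]_l)
    (d : 'rV[R]_l) : 'M[R]_l :=
  Num.sqrt (theta / mu) *: (diag_mx (map_mx Num.sqrt d) *m U^T).

Definition schur_mp (R : realType) m k l (A1 : 'M[R]_(m, k))
    (A2 : 'M[R]_(m, l)) : 'M[R]_l :=
  A2^T *m A2 - A2^T *m A1 *m mpinv (A1^T *m A1) *m A1^T *m A2.

(* Main.v *)
Require Import Defs.
From HB Require Import structures.
From mathcomp Require Import all_boot all_order all_algebra.
From mathcomp Require Import all_classical all_reals all_analysis.
From mathcomp Require Import ring lra.
Import Order.TTheory GRing.Theory Num.Theory.
Import numFieldNormedType.Exports.

Local Open Scope classical_set_scope.
Local Open Scope ring_scope.

(** The minimum subtracted in [bPsi_B] is a minimum over [v] of functions of the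
    argument, so subtracting it turns [J_c] into a maximum.  Writing
    [Psi = EFin \o psi], which the full domain allows, [J_c x] is the maximum
    over [v] of
      1/2 |y - A x|^2 - mu/2 |B (L x - v)|^2 + mu psi (L x) - mu psi v
    plus the indicator of the constraint [Cop x \in Cset].

    The maximum is attained because [psi] is lower semicontinuous and coercive
    ([prox_objective_min]).  Convexity and lower semicontinuity therefore pass
    from the members of this family to [J_c] ([Gamma0_attained_sup]), and [J_c]
    is finite exactly where the constraint holds, which happens somewhere.

    For fixed [v] the first two terms form a quadratic function of [x] with
    Hessian [A^T A - mu L^T B^T B L], so everything reduces to the inequality
    [mu |B L x|^2 <= |A x|^2] ([B_theta_bound]).  In the coordinates
    [Lt x = (w1, w2)] one has [A x = A1 w1 + A2 w2] and [L x = w2].  The matrix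
    [schur_mp A1 A2] is the quadratic form
      w2 |-> min_w1 |A1 w1 + A2 w2|^2,
    since [A1 (A1^T A1)^+ A1^T] is the orthogonal projection onto the range of
    [A1] ([enorm2_schur]).  The form is thus nonnegative, which makes the
    square roots in [B_theta] genuine, and is bounded above by [|A x|^2].
    Finally [mu |B_theta w2|^2] is [theta] times this form, and
    [theta <= 1]. *)

Set Implicit Arguments.
Unset Strict Implicit.
Unset Printing Implicit Defensive.

(** * The squared Euclidean norm *)

Section EuclideanNorm.
Context {R : realType}.

Lemma enorm2E n (v : 'cV[R]_n) : enorm2 v = \sum_i v i 0 ^+ 2.
Proof. by rewrite /enorm2 mxE; apply: eq_bigr => i _; rewrite mxE expr2. Qed.

Lemma enorm2_ge0 n (v : 'cV[R]_n) : 0 <= enorm2 v.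
Proof. by rewrite enorm2E sumr_ge0// => i _; rewrite sqr_ge0. Qed.

Lemma enorm20 n : enorm2 (0 : 'cV[R]_n) = 0.
Proof. by rewrite /enorm2 mulmx0 mxE. Qed.

Lemma enorm2Z n (a : R) (v : 'cV[R]_n) : enorm2 (a *: v) = a ^+ 2 * enorm2 v.
Proof.
by rewrite !enorm2E mulr_sumr; apply: eq_bigr => i _; rewrite mxE exprMn.
Qed.

Lemma enorm2D_orthogonal n (u v : 'cV[R]_n) :
  u^T *m v = 0 -> enorm2 (u + v) = enorm2 u + enorm2 v.
Proof.
move=> uv; have vu : v^T *m u = 0.
  by rewrite -[LHS]trmxK trmx_mul trmxK uv trmx0.
by rewrite /enorm2 (raddfD trmx)/= mulmxDl !mulmxDr uv vu addr0 add0r mxE.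
Qed.

(** The defect of convexity of the squared norm is again a squared norm, so that
    convexity of a difference of two quadratics becomes an inequality between
    their values at [u - v]. *)
Lemma enorm2_conv n (t : R) (u v : 'cV[R]_n) :
  enorm2 (t *: u + (1 - t) *: v) =
  t * enorm2 u + (1 - t) * enorm2 v - t * (1 - t) * enorm2 (u - v).
Proof.
rewrite !enorm2E !mulr_sumr -big_split/= -sumrB.
by apply: eq_bigr => i _; rewrite !mxE; ring.
Qed.

Lemma coord_le_enorm n (v : 'cV[R]_n) i : `|v i 0| <= enorm v.
Proof.
rewrite -sqrtr_sqr ler_wsqrtr// enorm2E (bigD1 i)//= lerDl.
by rewrite sumr_ge0// => j _; rewrite sqr_ge0.
Qed.

(** Bridge from coercivity, which uses the Euclidean norm, to boundedness, which
    refers to the sup norm of matrices. *)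
Lemma enorm_le_bounded n (r : R) (S : set 'cV[R]_n) :
  (forall v, S v -> enorm v <= r) -> bounded_set S.
Proof.
move=> Sr; exists r; split=> [|M rM v Sv]; first exact: num_real.
have M0 : 0 <= M.
  by rewrite (le_trans _ (ltW rM))// (le_trans _ (Sr _ Sv))// sqrtr_ge0.
rewrite /= [leLHS]/Num.norm/= mx_normrE; apply: bigmax_le => // -[i j] _ /=.
by rewrite [j]ord1 (le_trans (coord_le_enorm _ i))// (le_trans (Sr _ Sv))// ltW.
Qed.

End EuclideanNorm.

(** * The generalised Schur complement as a partial minimum *)

Section SchurComplement.
Context {R : realType}.

(** The transpose of a Moore-Penrose inverse of [G] is one of [G^T], hence of
    [G], and Moore-Penrose inverses are unique. *)
Lemma mpinv_sym n (G : 'M[R]_n) : G^T = G -> (mpinv G)^T = mpinv G.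
Proof.
move=> GT; have [a1 a2 a3 a4] := mpinvP G.
apply: is_mpinv_uniq (mpinvP G); split.
- by move/(congr1 trmx): a1; rewrite !trmx_mul GT mulmxA.
- by move/(congr1 trmx): a2; rewrite !trmx_mul GT mulmxA.
- by rewrite trmx_mul trmxK GT -a4 trmx_mul GT.
- by rewrite trmx_mul trmxK GT -a3 trmx_mul GT.
Qed.

Lemma gram_eq0 m n (D : 'M[R]_(m, n)) : D^T *m D = 0 -> D = 0.
Proof.
move=> /matrixP DD; apply/matrixP => i j; rewrite [RHS]mxE.
move: (DD j j); rewrite !mxE => /psumr_eq0P {}DD.
have /eqP : D^T j i * D i j = 0.
  by apply: DD => // s _; rewrite mxE -expr2 sqr_ge0.
by rewrite mxE -expr2 sqrf_eq0 => /eqP.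
Qed.

(** The difference [D] of both sides has the form [A *m E], and [A^T] kills it by
    the first Moore-Penrose equation; hence [D^T *m D = 0]. *)
Lemma mulmx_mpinv_gram m k (A : 'M[R]_(m, k)) :
  A *m mpinv (A^T *m A) *m (A^T *m A) = A.
Proof.
have [+ _ _ _] := mpinvP (A^T *m A).
set X := mpinv _ => gXg; apply/eqP; rewrite -subr_eq0; apply/eqP/gram_eq0.
have AD : A^T *m (A *m X *m (A^T *m A) - A) = 0.
  by rewrite mulmxBr !mulmxA; rewrite !mulmxA in gXg; rewrite gXg subrr.
have DE : A *m X *m (A^T *m A) - A = A *m (X *m (A^T *m A) - 1%:M).
  by rewrite mulmxBr mulmx1 !mulmxA.
move: (_ - A) AD DE => D AD DE; by rewrite {1}DE trmx_mul -mulmxA AD mulmx0.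
Qed.

(** Pythagoras: [A2 w2] splits into its projection on the range of [A1] and an
    orthogonal residual whose squared norm is the Schur form at [w2]. *)
Lemma enorm2_schur m k l (A1 : 'M[R]_(m, k)) (A2 : 'M[R]_(m, l))
    (w1 : 'cV[R]_k) (w2 : 'cV[R]_l) :
  enorm2 (A1 *m w1 + A2 *m w2) =
  enorm2 (A1 *m (w1 + mpinv (A1^T *m A1) *m A1^T *m A2 *m w2)) +
  (w2^T *m schur_mp A1 A2 *m w2) 0 0.
Proof.
have XT : (mpinv (A1^T *m A1))^T = mpinv (A1^T *m A1).
  by apply: mpinv_sym; rewrite trmx_mul trmxK.
have P := mulmx_mpinv_gram A1.
rewrite /schur_mp; set X := mpinv _ in XT P *.
(* The component of [A2 *m w2] orthogonal to the range of [A1]. *)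
pose r := A2 *m w2 - A1 *m X *m A1^T *m A2 *m w2.
have PT : A1^T *m A1 *m X *m A1^T = A1^T.
  by move/(congr1 trmx): P; rewrite !trmx_mul XT trmxK !mulmxA.
have A1r p (u : 'M[R]_(k, p)) : (A1 *m u)^T *m r = 0.
  by rewrite trmx_mul -mulmxA [A1^T *m r]mulmxBr !mulmxA PT subrr mulmx0.
have -> : A1 *m w1 + A2 *m w2 = A1 *m (w1 + X *m A1^T *m A2 *m w2) + r.
  by rewrite mulmxDr !mulmxA -addrA; congr (_ + _); rewrite addrC subrK.
rewrite enorm2D_orthogonal//.
congr (_ + _); rewrite /enorm2 {1}/r (raddfB trmx)/= mulmxBl.
have -> : (A1 *m X *m A1^T *m A2 *m w2)^T *m r = 0.
  by rewrite -!mulmxA A1r.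
by rewrite subr0 /r trmx_mul mulmxBr !mulmxBr mulmxBl !mulmxA.
Qed.

Lemma schur_mp_le m k l (A1 : 'M[R]_(m, k)) (A2 : 'M[R]_(m, l))
    (w1 : 'cV[R]_k) (w2 : 'cV[R]_l) :
  (w2^T *m schur_mp A1 A2 *m w2) 0 0 <= enorm2 (A1 *m w1 + A2 *m w2).
Proof. by rewrite enorm2_schur lerDr enorm2_ge0. Qed.

(** The Schur form is a squared norm: choose [w1] so that the projected part in
    [enorm2_schur] vanishes. *)
Lemma schur_mp_ge0 m k l (A1 : 'M[R]_(m, k)) (A2 : 'M[R]_(m, l))
    (w : 'cV[R]_l) :
  0 <= (w^T *m schur_mp A1 A2 *m w) 0 0.
Proof.
have := enorm2_schur A1 A2 (- (mpinv (A1^T *m A1) *m A1^T *m A2 *m w)) w.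
by rewrite addNr mulmx0 enorm20 add0r => <-; exact: enorm2_ge0.
Qed.

(** [d 0 i] is the value of the form at the [i]-th column of [U]. *)
Lemma eigenvalue_ge0 l (S U : 'M[R]_l) d :
  is_eigendecomposition S U d ->
  (forall w : 'cV[R]_l, 0 <= (w^T *m S *m w) 0 0) ->
  forall i, 0 <= d 0 i.
Proof.
move=> [UU US] S0 i; have := S0 (col i U).
rewrite -US !colE trmx_mul !mulmxA -(mulmxA _ U^T U) UU mulmx1.
rewrite -!mulmxA (mulmxA U^T) UU mul1mx trmx_delta -rowE -colE.
by rewrite !mxE eqxx.
Qed.

(** [B_theta] is the scaled square root [D^(1/2) U^T] of [S = U D U^T]; the factor
    [mu] cancels the one in [theta / mu]. *)
Lemma enorm2_B_theta l (theta mu : R) (S U : 'M[R]_l) d (w : 'cV[R]_l) :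
  is_eigendecomposition S U d -> (forall i, 0 <= d 0 i) ->
  0 <= theta -> 0 < mu ->
  mu * enorm2 (B_theta theta mu U d *m w) = theta * (w^T *m S *m w) 0 0.
Proof.
move=> [_ <-] d0 th0 mu0.
rewrite /B_theta -scalemxAl enorm2Z sqr_sqrtr ?divr_ge0// 1?ltW//.
rewrite mulrA mulrCA divff ?gt_eqF// mulr1; congr (_ * _).
rewrite /enorm2 !trmx_mul trmxK tr_diag_mx !mulmxA; congr (fun_of_matrix _ 0 0).
do 2 congr (_ *m _); rewrite -!mulmxA; do 2 congr (_ *m _).
rewrite mulmx_diag; congr diag_mx.
by apply/rowP => i; rewrite !mxE -expr2 sqr_sqrtr.
Qed.

(** In the coordinates [Lt *m x] the matrix [L] selects the lower block, so the
    left side is [theta <= 1] times the minimum of the right side over the upper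
    block. *)
Lemma B_theta_bound (m k l : nat) (A : 'M[R]_(m, k + l))
    (L : 'M[R]_(l, k + l)) (mu theta : R) (Lt : 'M[R]_(k + l))
    (A1 : 'M[R]_(m, k)) (A2 : 'M[R]_(m, l)) (U : 'M[R]_l) (d : 'rV[R]_l) x :
  0 < mu -> 0 <= theta <= 1 -> Lt \in unitmx ->
  row_mx (0 : 'M[R]_(l, k)) 1%:M *m Lt = L ->
  row_mx A1 A2 = A *m invmx Lt ->
  is_eigendecomposition (schur_mp A1 A2) U d ->
  mu * enorm2 (B_theta theta mu U d *m (L *m x)) <= enorm2 (A *m x).
Proof.
move=> mu0 /andP[th0 th1] Ltu <- A12 eig.
have d0 := eigenvalue_ge0 eig (schur_mp_ge0 A1 A2).
have -> : A *m x = row_mx A1 A2 *m (Lt *m x) by rewrite A12 mulmxA mulmxKV.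
rewrite -(mulmxA _ Lt) -(vsubmxK (Lt *m x)) !mul_row_col mul0mx add0r mul1mx.
rewrite (enorm2_B_theta _ eig)//; apply: le_trans (schur_mp_le A1 A2 _ _).
by rewrite ler_piMl// schur_mp_ge0.
Qed.

End SchurComplement.

(** * Continuity and compactness for column vectors *)

Section Continuity.
Context {R : realType}.

Lemma linear_mx_continuous (V : normedModType R) m n
  (f : {linear 'M[R]_(m, n) -> V}) : continuous f.
Proof.
have -> : f = (fun M : 'M[R]_(m, n) =>
    \sum_i \sum_j M i j *: f (delta_mx i j)) :> (_ -> _).
  apply/funext => M; rewrite {1}(matrix_sum_delta M) linear_sum.
  apply: eq_bigr => i _; rewrite linear_sum.
  by apply: eq_bigr => j _; rewrite linearZ.
apply: continuous_big => [|i _]; first exact: add_continuous.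
apply: continuous_big => [|j _ M]; first exact: add_continuous.
by apply: (@cvgZr_tmp _ _ _ (nbhs M)); exact: coord_continuous.
Qed.

Lemma enorm2_affine_continuous p n (b : 'cV[R]_p) (M : 'M[R]_(p, n)) :
  continuous (fun x : 'cV[R]_n => enorm2 (b - M *m x)).
Proof.
have -> : (fun x : 'cV[R]_n => enorm2 (b - M *m x)) =
    (fun x => \sum_i (b i 0 - (M *m x) i 0) * (b i 0 - (M *m x) i 0)).
  apply/funext => x; rewrite enorm2E.
  by apply: eq_bigr => i _; rewrite !mxE expr2.
apply: continuous_big => [|i _ x]; first exact: add_continuous.
have c : {for x, continuous (fun x : 'cV[R]_n => b i 0 - (M *m x) i 0)}.
  apply: (@cvgB _ _ _ (nbhs x)); first exact: cvg_cst.
  apply: (@continuous_comp _ _ _ (mulmx M) (fun N : 'cV[R]_p => N i 0)).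
    exact: linear_mx_continuous.
  exact: coord_continuous.
exact: (cvgM c c).
Qed.

(** Transported along transposition from the case of row vectors. *)
Lemma bounded_closed_compact_cV n (S : set 'cV[R]_n) :
  bounded_set S -> closed S -> compact S.
Proof.
move=> [M [Mr SM]] Sc.
have trc p q : continuous (@trmx R p q) by exact: linear_mx_continuous.
have -> : S = (@trmx R 1 n) @` ((@trmx R 1 n) @^-1` S).
  apply/seteqP; split=> [v Sv|_ [w Sw <-]//].
  by exists v^T; rewrite /= trmxK.
apply: continuous_compact; first exact/continuous_subspaceT/trc.
apply: bounded_closed_compact; last first.
  by move/continuous_closedP : (@trc 1%N n); exact.
exists M; split=> // N MN w Sw.
(* Transposition does not increase the sup norm. *)
apply: le_trans (SM N MN _ Sw).
rewrite /= ![`|_|]/Num.norm/= !mx_normrE; apply: bigmax_le => [|[i j] _ /=].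
  exact: bigmax_ge_id.
rewrite -[w i j]/(w i j) -(mxE trmx_key (fun i j => w j i) j i).
exact: (le_bigmax _ (fun ij => `|w^T ij.1 ij.2|) (j, i)).
Qed.

End Continuity.

(** * Lower semicontinuous functions attain their minimum *)

Section LowerSemicontinuity.
Context {R : realType}.

Lemma lsc_comp (X Y : topologicalType) (f : Y -> \bar R) (g : X -> Y) :
  lower_semicontinuous f -> continuous g -> lower_semicontinuous (f \o g).
Proof.
move=> fl gc x a /fl[V Vx Vf]; exists (g @^-1` V); first exact: gc.
by move=> y /Vf.
Qed.

Lemma lscD_continuous (X : topologicalType) (f q : X -> R) :
  lower_semicontinuous (EFin \o f) -> continuous q ->
  lower_semicontinuous (EFin \o (f \+ q)).
Proof.
move=> fl qc x a; rewrite /= lte_fin => afq.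
(* The slack [f x + q x - a] is shared equally between [f] and [q]. *)
pose e := (f x + q x - a) / 2.
have e0 : 0 < e by rewrite divr_gt0// subr_gt0.
have [V Vx Vf] : exists2 V, nbhs x V &
    forall y, V y -> ((f x - e)%:E < (f y)%:E)%E.
  by apply: fl; rewrite /= lte_fin gtrBl.
exists (V `&` [set y | q x - e < q y]).
  apply: filterI => //; apply: (qc x [set r | q x - e < r]).
  by apply: lt_nbhsr; rewrite gtrBl.
move=> y [/Vf + /= qy]; rewrite !lte_fin => fy.
have eE : e + e = f x + q x - a by rewrite /e -splitr.
lra.
Qed.

Lemma lscZ (X : topologicalType) (c : R) (f : X -> R) : 0 < c ->
  lower_semicontinuous (EFin \o f) ->
  lower_semicontinuous (EFin \o (fun x => c * f x)).
Proof.
move=> c0 fl x a; rewrite /= lte_fin -ltr_pdivrMl// => ax.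
have [V Vx Vf] := fl x (c^-1 * a) ax.
by exists V => // y /Vf; rewrite /= !lte_fin ltr_pdivrMl.
Qed.

Lemma seq_argmin (T : eqType) (f : T -> R) (s : seq T) x0 : x0 \in s ->
  exists2 x, x \in s & forall y, y \in s -> f x <= f y.
Proof.
elim: s x0 => // x s IH x0 _.
have [->|[y ys]] : s = [::] \/ exists y, y \in s.
  by case: s {IH} => [|y s]; [left|right; exists y; exact: mem_head].
  by exists x; [exact: mem_head|move=> y; rewrite mem_seq1 => /eqP ->].
have [w ws wmin] := IH _ ys; have [xw|/ltW wx] := leP (f x) (f w).
  exists x; first exact: mem_head.
  by move=> z /[!inE] /predU1P[->//|/wmin]; exact: le_trans.
exists w; first by rewrite inE ws orbT.
by move=> z /[!inE] /predU1P[->//|/wmin].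
Qed.

(** If no point of [K] were a minimiser, the open sets [[set v | f w < f v]] for
    [w] in [K] would cover [K]; but the best [w] of a finite subcover lies in
    none of its members. *)
Lemma lsc_compact_min (X : ptopologicalType) (K : set X) (f : X -> R) :
  compact K -> K !=set0 -> lower_semicontinuous (EFin \o f) ->
  exists2 v, K v & forall w, K w -> f v <= f w.
Proof.
move=> Kc [v0 Kv0] /lower_semicontinuousP fl; apply: contrapT => nomin.
have worse v : K v -> exists2 w, K w & f w < f v.
  move=> Kv; apply: contrapT => nw; apply: nomin; exists v => // w Kw.
  by rewrite leNgt; apply/negP => wv; apply: nw; exists w.
move: Kc; rewrite compact_cover.
move=> /(_ _ K (fun w => [set v | f w < f v])) [||D DK cov].
- by move=> w _; have := fl (f w); under eq_set do rewrite /= lte_fin.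
- by move=> v /worse[w Kw wv]; exists w.
have [w0 w0D _] := cov _ Kv0.
have [w wD wmin] := seq_argmin f w0D.
have /set_mem Kw : w \in K by exact: DK.
by have [w' w'D /=] := cov _ Kw; rewrite ltNge wmin.
Qed.

Lemma lsc_coercive_min n (f : 'cV[R]_n -> R) :
  lower_semicontinuous (EFin \o f) -> coercive (EFin \o f) ->
  exists v, forall w, f v <= f w.
Proof.
move=> fl /(_ (f 0))[r fr].
(* A minimiser over the sublevel set of [f 0] is a global one. *)
pose K := [set v | f v <= f 0].
have Kc : compact K.
  apply: bounded_closed_compact_cV.
    apply: (@enorm_le_bounded _ _ r) => v /= v0; rewrite leNgt; apply/negP.
    by move=> /fr; rewrite lte_fin ltNge v0.
  have -> : K = ~` [set v | f 0 < f v].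
    by apply/seteqP; split=> v; rewrite /K/=;
      [rewrite leNgt => /negP|move/negP; rewrite -leNgt].
  apply: open_closedC; move/lower_semicontinuousP : fl => /(_ (f 0)).
  by under eq_set do rewrite /= lte_fin.
have [|v Kv vmin] := lsc_compact_min Kc _ fl; first by exists 0; rewrite /K/=.
exists v => w; have [/vmin//|] := leP (f w) (f 0).
by move/ltW; exact: le_trans.
Qed.

End LowerSemicontinuity.

(** * Stability of proper lower semicontinuous convex functions *)

Section Gamma0.
Context {R : realType}.

(** As the supremum is attained, each property of [f] at a point can be read off
    from the one minorant that touches [f] there; for convexity that point is
    the convex combination. *)
Lemma Gamma0_attained_sup (H : normedModType R) (f : H -> \bar R) :
  (exists x, f x < +oo)%E ->
  (forall x, exists2 h, Gamma0 h & (forall y, h y <= f y)%E /\ h x = f x) ->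
  Gamma0 f.
Proof.
move=> fin sup; split.
- split=> // x; have [h [[hNy _] _ _] [_ <-]] := sup x; exact: hNy.
- move=> x a; have [h [_ hl _] [hf <-]] := sup x.
  by move=> /hl[V Vx Vh]; exists V => // y /Vh /lt_le_trans; exact.
- move=> x y t t01; have [h [_ _ hc] [hf <-]] := sup (t *: x + (1 - t) *: y).
  have [/ltW t0 /ltW t1] := andP t01.
  apply: (le_trans (hc x y t t01)).
  by apply: leeD; apply: lee_wpmul2l; rewrite ?lee_fin ?subr_ge0.
Qed.

Lemma Gamma0_constrained (H V : normedModType R) (h : H -> R)
    (T : {linear H -> V}) (C : set V) :
  lower_semicontinuous (EFin \o h) -> econvex (EFin \o h) -> continuous T ->
  closed C -> convex_set C -> C `&` range T !=set0 ->
  Gamma0 (fun x => (h x)%:E + eindicator C (T x))%E.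
Proof.
move=> hl hc Tc Ccl Ccv [_ [/[swap] -[x0 _ <-] Cx0]]; split.
- split=> [x|]; first by rewrite /eindicator; case: ifP.
  by exists x0; rewrite /eindicator mem_set//= adde0 ltry.
- move=> x a; rewrite /eindicator.
  case: ifPn => [_|Tx _].
    rewrite adde0 => /hl[W Wx Wh]; exists W => // y /Wh ay.
    by case: ifP => _; [rewrite adde0|rewrite addey// ltry].
  exists (T @^-1` (~` C)).
    apply: Tc; apply: open_nbhs_nbhs; split; first exact: closed_openC.
    by move=> Cx'; rewrite mem_set in Tx.
  by move=> y /= nC; rewrite memNset// addey// ltry.
- move=> x y t t01; have /andP[t0 t1] := t01.
  have t1' : 0 < 1 - t by rewrite subr_gt0.
  rewrite /eindicator; case: ifPn => Tz.
    rewrite adde0; apply: (le_trans (hc x y t t01)).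
    apply: leeD; (apply: lee_wpmul2l; first by rewrite lee_fin ltW);
      by case: ifP => _; rewrite ?adde0// addey// leey.
  have [Txy|] := boolP ((T x \in C) && (T y \in C)); last first.
    (* An endpoint violates the constraint: the right-hand side is [+oo]. *)
    rewrite negb_and => /orP[] /negbTE ->; rewrite addey// gt0_muley ?lte_fin//;
      case: ifP => _; rewrite ?adde0 ?addey// ?gt0_muley ?lte_fin//;
      by rewrite ?addye ?addey// ?leey.
  have /andP[Tx Ty] := Txy.
  have := Ccv _ _ (Itv01 (ltW t0) (ltW t1)) Tx Ty.
  by rewrite /conv/= -!linearZ -linearD (negbTE Tz).
Qed.

End Gamma0.

(** * The nonconvexly regularised objective *)

Section Model.
Context {R : realType} {m n l : nat} {Z : finDimNormedModType R}.
Variables (ip : {dot Z for idfun}) (A : 'M[R]_(m, n)) (L : 'M[R]_(l, n)).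
Variables (mu : R) (y : 'cV[R]_m) (Cset : set Z) (Cop : {linear 'cV[R]_n -> Z}).
Variables (psi : 'cV[R]_l -> R) (B : 'M[R]_l).

(** The function of [v] minimised in [bPsi_B], at first component [u] of its
    argument; the [Z] component only contributes the indicator. *)
Definition prox_objective (u v : 'cV[R]_l) : R :=
  psi v + 2^-1 * enorm2 (B *m (u - v)).

(** Apart from the constraint, [J_c] is the maximum of these functions over [v]: the
    minimum inside [bPsi_B] is replaced by its objective at the fixed point [v]. *)
Definition minorant (v : 'cV[R]_l) (x : 'cV[R]_n) : R :=
  2^-1 * enorm2 (y - A *m x) + mu * (psi (L *m x) - prox_objective (L *m x) v).

Lemma prox_objective_min u :
  lower_semicontinuous (EFin \o psi) -> coercive (EFin \o psi) ->
  exists v, forall w, prox_objective u v <= prox_objective u w.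
Proof.
move=> psil psic; apply: lsc_coercive_min.
  apply: lscD_continuous => //.
  have -> : (fun v => 2^-1 * enorm2 (B *m (u - v))) =
      (fun v => 2^-1 * enorm2 (B *m u - B *m v)).
    by apply/funext => v; rewrite mulmxBr.
  move=> v; apply: (@cvgM _ _ (nbhs v)); first exact: cvg_cst.
  exact: enorm2_affine_continuous.
move=> M; have [r rM] := psic M; exists r => z /rM.
rewrite !lte_fin => /lt_le_trans; apply.
by rewrite lerDl mulr_ge0// ?invr_ge0// enorm2_ge0.
Qed.

(** Where the constraint fails the subtracted minimum is still finite, so the
    value [+oo] of the indicator survives the subtraction. *)
Lemma J_cE (v : 'cV[R]_l) (x : 'cV[R]_n) :
  0 < mu -> Cset !=set0 ->
  (forall w, prox_objective (L *m x) v <= prox_objective (L *m x) w) ->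
  J_c ip A L mu y Cset Cop (EFin \o psi) B x =
  ((minorant v x)%:E + eindicator Cset (Cop x))%E.
Proof.
move=> mu0 [c Cc] vmin; rewrite /J_c /bPsi_B.
have sumE z w : 2^-1 * sum_norm2 ip (B_c B (z - w)) =
    2^-1 * enorm2 (B *m (z.1 - w.1)) :> R.
  by rewrite /sum_norm2 /B_c/= linear0l addr0.
have -> : emin (fun w => bPsi Cset (EFin \o psi) w +
    (2^-1 * sum_norm2 ip (B_c B (L_c L Cop x - w)))%:E)%E =
    (prox_objective (L *m x) v)%:E.
  rewrite (@eminE _ _ _ (v, c)).
    by rewrite sumE /bPsi /eindicator mem_set//= adde0.
  move=> w; rewrite !sumE /bPsi /eindicator mem_set//= adde0.
  case: ifP => _; last by rewrite addey// addye// leey.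
  by rewrite adde0 -!EFinD lee_fin; exact: vmin.
rewrite /bPsi /eindicator/=; case: ifP => _.
  by rewrite !adde0 -EFinB -EFinM -EFinD.
by rewrite !addey// addye// gt0_muley ?lte_fin// addey.
Qed.

Lemma minorant_lsc v : 0 < mu ->
  lower_semicontinuous (EFin \o psi) ->
  lower_semicontinuous (EFin \o minorant v).
Proof.
move=> mu0 psil.
(* A positive multiple of [psi \o L] plus a continuous quadratic function. *)
have -> : minorant v = (fun x => mu * psi (L *m x)) \+
    (fun x => 2^-1 * enorm2 (y - A *m x) -
      mu * (psi v + 2^-1 * enorm2 (B *m v - (B *m L) *m x))).
  apply/funext => x; rewrite /minorant /prox_objective /=.
  have -> : B *m (L *m x - v) = (-1) *: (B *m v - B *m L *m x).
    by rewrite scaleN1r opprB mulmxBr mulmxA.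
  by rewrite enorm2Z; ring.
apply: lscD_continuous.
  apply: lscZ => //.
  have := @lsc_comp _ _ _ (EFin \o psi) (mulmx L : 'cV[R]_n -> 'cV[R]_l) psil.
  by apply; exact: linear_mx_continuous.
move=> x; apply: (@cvgB _ _ _ (nbhs x)).
  apply: (@cvgM _ _ (nbhs x)); first exact: cvg_cst.
  exact: enorm2_affine_continuous.
apply: (@cvgM _ _ (nbhs x)); first exact: cvg_cst.
apply: (@cvgD _ _ _ (nbhs x)); first exact: cvg_cst.
apply: (@cvgM _ _ (nbhs x)); first exact: cvg_cst.
exact: enorm2_affine_continuous.
Qed.

(** The quadratic part has the convexity defect
    [t (1 - t) / 2 * (|A z|^2 - mu |B L z|^2)] with [z = b - a], nonnegative by
    assumption; the remaining part is convex because [psi] is. *)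
Lemma minorant_convex v : 0 < mu ->
  (forall x, mu * enorm2 (B *m (L *m x)) <= enorm2 (A *m x)) ->
  econvex (EFin \o psi) -> econvex (EFin \o minorant v).
Proof.
move=> mu0 BA psic a b t t01; have /andP[t0 t1] := t01.
have := psic (L *m a) (L *m b) t t01.
rewrite /= -!EFinM -!EFinD !lee_fin => psit.
have LE : L *m (t *: a + (1 - t) *: b) = t *: (L *m a) + (1 - t) *: (L *m b).
  by rewrite mulmxDr -!scalemxAr.
rewrite /minorant /prox_objective LE.
have yE : y - A *m (t *: a + (1 - t) *: b) =
    t *: (y - A *m a) + (1 - t) *: (y - A *m b).
  by apply/colP => i; rewrite mulmxDr -!scalemxAr !mxE; ring.
have vE : B *m (t *: (L *m a) + (1 - t) *: (L *m b) - v) =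
    t *: (B *m (L *m a - v)) + (1 - t) *: (B *m (L *m b - v)).
  rewrite !(scalemxAr _ B) -mulmxDr; congr (_ *m _).
  by apply/colP => i; rewrite !mxE; ring.
rewrite yE vE !enorm2_conv.
have -> : y - A *m a - (y - A *m b) = A *m (b - a).
  by rewrite mulmxBr; apply/colP => i; rewrite !mxE; ring.
have -> : B *m (L *m a - v) - B *m (L *m b - v) = (-1) *: (B *m (L *m (b - a))).
  rewrite -mulmxBr scaleN1r -mulmxN; congr (_ *m _); rewrite mulmxBr.
  by apply/colP => i; rewrite !mxE; ring.
have -> : enorm2 ((-1) *: (B *m (L *m (b - a)))) = enorm2 (B *m (L *m (b - a))).
  by rewrite enorm2Z; ring.
have := BA (b - a).
move: (enorm2 (B *m (L *m (b - a)))) (enorm2 (A *m _)) => p q pq.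
have h1 : 0 <= t * (1 - t) * (q - mu * p).
  by rewrite mulr_ge0// ?subr_ge0// mulr_ge0// ?subr_ge0 ltW.
have h2 : 0 <= mu * (t * psi (L *m a) + (1 - t) * psi (L *m b) -
    psi (t *: (L *m a) + (1 - t) *: (L *m b))).
  by rewrite mulr_ge0 ?subr_ge0 ?(ltW mu0).
rewrite -subr_ge0; set P := psi (_ + _) in h2 *; set E := (X in 0 <= X).
suff -> : E = 2^-1 * (t * (1 - t) * (q - mu * p)) +
    mu * (t * psi (L *m a) + (1 - t) * psi (L *m b) - P).
  by rewrite addr_ge0// mulr_ge0// invr_ge0.
rewrite /E; ring.
Qed.

Lemma Gamma0_J_c : 0 < mu -> closed Cset -> convex_set Cset ->
  Cset `&` range Cop !=set0 ->
  Gamma0 (EFin \o psi) -> coercive (EFin \o psi) ->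
  (forall x, mu * enorm2 (B *m (L *m x)) <= enorm2 (A *m x)) ->
  Gamma0 (J_c ip A L mu y Cset Cop (EFin \o psi) B).
Proof.
move=> mu0 Ccl Ccv Cran [_ psil psicv] psico BA.
have C0 : Cset !=set0 by have [c [Cc _]] := Cran; exists c.
have minE x := prox_objective_min (L *m x) psil psico.
apply: Gamma0_attained_sup => [|x].
  have [_ [/[swap] -[x _ <-] Cx]] := Cran; exists x; have [v vmin] := minE x.
  by rewrite (J_cE mu0 C0 vmin) /eindicator mem_set//= adde0 ltry.
have [v vmin] := minE x.
exists (fun x => (minorant v x)%:E + eindicator Cset (Cop x))%E.
  apply: Gamma0_constrained => //.
  - exact: minorant_lsc.
  - exact: minorant_convex.
  - exact: linear_mx_continuous.
split; last by rewrite -(J_cE mu0 C0 vmin).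
move=> z; have [w wmin] := minE z; rewrite (J_cE mu0 C0 wmin) leeD2r//.
by rewrite lee_fin lerD2l ler_pM2l// lerD2l lerN2.
Qed.

End Model.

Unset Implicit Arguments.

(* The dimension n is written k + l, so k = n - l; rank L = l forces l <= n. *)
Theorem proposition2 (R : realType) (m k l : nat)
    (Z : finDimNormedModType R) (ip : {dot Z for idfun})
    (ip_norm : forall z : Z, `|z| ^+ 2 = ip z z)
    (A : 'M[R]_(m, k + l)) (L : 'M[R]_(l, k + l)) (mu : R) (mu_gt0 : 0 < mu)
    (rankL : \rank L = l)
    (Cset : set Z) (Cset0 : Cset !=set0) (Cset_closed : closed Cset)
    (Cset_convex : convex_set Cset)
    (Cop : {linear 'cV[R]_(k + l) -> Z})
    (Cset_ran : Cset `&` range Cop !=set0)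
    (Psi : 'cV[R]_l -> \bar R) (Psi_Gamma0 : Gamma0 Psi)
    (Psi_coercive : coercive Psi) (Psi_dom : edom Psi = setT)
    (y : 'cV[R]_m)
    (Lt : 'M[R]_(k + l)) (Lt_unit : Lt \in unitmx)
    (Lt_L : row_mx (0 : 'M[R]_(l, k)) 1%:M *m Lt = L)
    (A1 : 'M[R]_(m, k)) (A2 : 'M[R]_(m, l))
    (A12 : row_mx A1 A2 = A *m invmx Lt)
    (U : 'M[R]_l) (d : 'rV[R]_l)
    (eigU : is_eigendecomposition (schur_mp A1 A2) U d)
    (theta : R) (theta01 : 0 <= theta <= 1) :
  Gamma0 (J_c ip A L mu y Cset Cop Psi (B_theta theta mu U d)).
Proof.
have [psi psiE] : exists psi, Psi = EFin \o psi.
  exists (fine \o Psi); apply/funext => z /=; rewrite fineK// fin_numElt.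
  have [[PsiNy _] _ _] := Psi_Gamma0.
  have : edom Psi z by rewrite Psi_dom.
  by rewrite /edom/= => ->; rewrite ltNye PsiNy.
rewrite psiE in Psi_Gamma0 Psi_coercive *.
apply: Gamma0_J_c => // x.
exact: B_theta_bound Lt_unit Lt_L A12 eigU.
Qed.
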